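(* Let $p(\cdot):\mathbb{N}\to[1,\infty)$ be an exponent function and suppose that for some $B>1$, $\sum_{k\in\mathbb{N}}B^{-p(k)}<\infty$. Then $(\ell^{p(\cdot)})^*$ is isomorphic to the external direct sum $\ell^{p'(\cdot)}\oplus pba(\mathcal{B}(\mathbb{N}))$. In particular, in this case $(\ell^{p(\cdot)}_{\mathrm{germ}})^*$ is isomorphic to $pba(\mathcal{B}(\mathbb{N}))$.
   Context: Sequences are real. For $q(\cdot):\mathbb{N}\to[1,\infty]$, with $N_\infty=\{k:q(k)=\infty\}$, the modular is $\rho_{q(\cdot)}(x)=\sum_{k\notin N_\infty}|x(k)|^{q(k)}+\sup_{k\in N_\infty}|x(k)|$, and $\ell^{q(\cdot)}$ is the Banach space of sequences $x$ with $\rho_{q(\cdot)}(x/\lambda)<\infty$ for some $\lambda>0$, normed by $\|x\|_{\ell^{q(\cdot)}}=\inf\{\lambda>0:\rho_{q(\cdot)}(x/\lambda)\le1\}$. The dual exponent is given by $1/p(k)+1/p'(k)=1$, with $1/\infty=0$. Let $\ell^{p(\cdot)}_b$ be the set of $x\in\ell^{p(\cdot)}$ with $p$ bounded on $\operatorname{supp}(x)=\{k:x(k)\neq0\}$, and let $\ell^{p(\cdot)}_{\mathrm{germ}}=\ell^{p(\cdot)}/\overline{\ell^{p(\cdot)}_b}$ with the quotient norm. $\mathcal{B}(\mathbb{N})$ is the $\sigma$-algebra of all subsets of $\mathbb{N}$, and $pba(\mathcal{B}(\mathbb{N}))$ is the space of finitely additive real-valued signed measures $\mu$ on $\mathcal{B}(\mathbb{N})$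 with finite total variation $|\mu|(\mathbb{N})<\infty$ that are purely finitely additive, i.e. $\mu(E)=0$ for all finite $E\subset\mathbb{N}$; it is normed by total variation. ''Isomorphic'' means there is a bounded linear bijection with bounded inverse. *)

(* Defs.v *)
From HB Require Import structures.
From mathcomp Require Import all_boot all_order all_algebra.
From mathcomp Require Import generic_quotient ring_quotient.
From mathcomp Require Import ring lra.
From mathcomp Require Import all_classical all_reals all_analysis.

Set Implicit Arguments.
Unset Strict Implicit.
Unset Printing Implicit Defensive.

Import Order.TTheory GRing.Theory Num.Theory.
Import numFieldNormedType.Exports.

Local Open Scope classical_set_scope.
Local Open Scope ring_scope.

Record exponent (R : realType) := Exponent {
  exponent_fun :> nat -> \bar R ;
  exponent_ge1 : forall k, (1 <= exponent_fun k)%E }.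

Definition real_exponent (R : realType) (p : nat -> R)
    (p_ge1 : forall k, 1 <= p k) : exponent R :=
  @Exponent R (fun k => (p k)%:E) p_ge1.

Definition dual_exponent (R : realType) (p : exponent R) : exponent R :=
  @Exponent R (fun k => hoelder_conjugate (p k))
    (fun k => hoelder_conj_ge1 (exponent_ge1 p k)).

Lemma dual_exponentP (R : realType) (p : exponent R) k :
  ((p k)^-1 + (dual_exponent p k)^-1 = 1)%E.
Proof.
have p0 : (0 < p k)%E by rewrite (lt_le_trans _ (exponent_ge1 p k)).
by apply: hoelder_conjugate_eq1; [exact: lt_trans p0|rewrite gt_eqF].
Qed.

Section modular.
Context {R : realType}.
Implicit Types (q : exponent R) (x y : nat -> R).

(* 0 is inserted because the supremum of the empty set is -oo in \bar R. *)
Definition modular q x : \bar R :=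
  (\sum_(0 <= k <oo | q k != +oo) (`|x k| `^ fine (q k))%:E
   + ereal_sup (0 |` [set `|x k|%:E | k in [set k | q k = +oo]]))%E.

Definition in_lspace q x : Prop :=
  exists2 l : R, 0 < l & (modular q (fun k => (x k / l)%R) < +oo)%E.

Definition luxemburg q x : R :=
  inf [set l : R | 0 < l /\ (modular q (fun k => (x k / l)%R) <= 1)%E].

Lemma fine_exponent_ge1 q k : q k != +oo%E -> 1 <= fine (q k).
Proof. by have := exponent_ge1 q k; case: (q k). Qed.

Let sum_ge0 q x :
  (0 <= \sum_(0 <= k <oo | q k != +oo) (`|x k| `^ fine (q k))%:E)%E.
Proof. by apply: nneseries_ge0 => k _ _; rewrite lee_fin powR_ge0. Qed.

Let sup_ge0 q x :
  (0 <= ereal_sup (0 |` [set `|x k|%:E | k in [set k | q k = +oo]]))%E.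
Proof. by apply: ereal_sup_ubound; left. Qed.

Lemma modular_ge0 q x : (0 <= modular q x)%E.
Proof. by rewrite adde_ge0. Qed.

Lemma modular0 q : modular q (fun=> 0) = 0%E.
Proof.
rewrite /modular eseries0 => [|k _ qk]; last first.
  rewrite normr0 powR0// gt_eqF// (lt_le_trans ltr01)//.
  exact: fine_exponent_ge1.
rewrite add0e; apply/eqP; rewrite eq_le sup_ge0 andbT.
by apply: ge_ereal_sup => _ [->//|[k _ <-]]; rewrite normr0.
Qed.

Lemma modular_norm q x y : (forall k, `|x k| = `|y k|) ->
  modular q x = modular q y.
Proof.
move=> xy; rewrite /modular; congr (_ + _)%E.
  by apply: eq_eseriesr => k _; rewrite xy.
by congr (ereal_sup (_ |` _)); apply: eq_imagel => k _; rewrite xy.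
Qed.

Lemma modular_convex q x y (a b : R) : 0 <= a -> 0 <= b -> a + b = 1 ->
  (modular q (fun k => (a * x k + b * y k)%R)
   <= a%:E * modular q x + b%:E * modular q y)%E.
Proof.
move=> a0 b0 ab1.
have t01 : 0 <= a <= 1 by rewrite a0 -ab1 lerDl.
have abE (u v : R) : `|a * u + b * v| <= a * `|u| + b * `|v|.
  rewrite (le_trans (ler_normD _ _))// !normrM.
  by rewrite (ger0_norm a0) (ger0_norm b0).
rewrite /modular !ge0_muleDr// addeACA; apply: leeD.
- rewrite -!nneseriesZl; [|by move=> *; rewrite lee_fin powR_ge0..].
  rewrite -nneseriesD; [|by move=> *; rewrite mule_ge0// lee_fin powR_ge0..].
  apply: lee_nneseries => [k _ _|k qk]; first by rewrite lee_fin powR_ge0.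
  have p1 := fine_exponent_ge1 qk.
  rewrite -!EFinM -EFinD lee_fin.
  have b1 : b = 1 - a by rewrite -ab1 addrAC subrr add0r.
  have := @convex_powR R _ p1 (Itv01 (andP t01).1 (andP t01).2) `|x k| `|y k|.
  rewrite !inE/= !in_itv/= !normr_ge0 => /(_ isT isT).
  rewrite [X in X `^ _ <= _]convRE convRE/= /unstable.onem -b1.
  apply: le_trans; apply: ge0_ler_powR;
    rewrite ?nnegrE ?(le_trans ler01 p1)// addr_ge0// mulr_ge0//.
- apply: ge_ereal_sup => _ [->|[k /= qk <-]].
    by rewrite adde_ge0// mule_ge0.
  apply: (@le_trans _ _ (a%:E * `|x k|%:E + b%:E * `|y k|%:E)%E).
    by rewrite -!EFinM -EFinD lee_fin.
  by apply: leeD; rewrite lee_wpmul2l ?lee_fin//;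
    apply: ereal_sup_ubound; right; exists k.
Qed.

Lemma modularZ_le q x (t : R) : 0 <= t <= 1 ->
  (modular q (fun k => (t * x k)%R) <= t%:E * modular q x)%E.
Proof.
move=> /andP[t0 t1].
have := @modular_convex q x (fun=> 0) t (1 - t) t0.
rewrite subr_ge0 t1 modular0 mule0 adde0 subrKC => /(_ isT erefl).
by rewrite (_ : (fun k => _) = (fun k => t * x k))//; apply/funext => k;
  rewrite mulr0 addr0.
Qed.

Lemma le_modular1 q x : (modular q x <= 1)%E -> forall k, `|x k| <= 1.
Proof.
move=> x1 k; rewrite leNgt; apply/negP => xk; move: x1; apply/negP.
rewrite -ltNge /modular.
have [qk|qk] := eqVneq (q k) +oo%E.
  rewrite (@lt_le_trans _ _ (`|x k|%:E)) ?lte_fin//.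
  rewrite (le_trans _ (leeDr _ _))//.
  by apply: ereal_sup_ubound; right; exists k.
rewrite (@lt_le_trans _ _ (`|x k| `^ fine (q k))%:E)//.
  rewrite lte_fin (lt_le_trans xk)// -{1}(powRr1 (normr_ge0 (x k))).
  by apply: ler_powR; [exact: ltW|exact: fine_exponent_ge1].
rewrite (le_trans _ (leeDl _ _))// (@nneseriesD1 _ _ k)//.
by rewrite leeDl// nneseries_ge0// => *; rewrite lee_fin powR_ge0.
Qed.

Let luxset q x :=
  [set l : R | 0 < l /\ (modular q (fun k => (x k / l)%R) <= 1)%E].

Lemma luxemburg_has_inf q x : in_lspace q x -> has_inf (luxset q x).
Proof.
move=> [l l0 xl]; split; last by exists 0 => m [/ltW].
pose M := fine (modular q (fun k => x k / l)).
have ME : modular q (fun k => x k / l) = M%:E.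
  by rewrite fineK// ge0_fin_numE// modular_ge0.
have M0 : 0 <= M by rewrite -lee_fin -ME modular_ge0.
have M1 : 0 < M + 1 by rewrite ltr_wpDl.
exists (l * (M + 1)); split; first by rewrite mulr_gt0.
rewrite (_ : (fun k => _) = (fun k => (M + 1)^-1 * (x k / l))); last first.
  by apply/funext => k; field; rewrite !gt_eqF.
apply: le_trans (modularZ_le _ _ _) _.
  by rewrite invr_ge0 ltW//= invf_le1// lerDr.
by rewrite ME -EFinM lee_fin mulrC ler_pdivrMr// mul1r lerDl.
Qed.

Lemma luxemburg_ge0 q x : 0 <= luxemburg q x.
Proof.
rewrite /luxemburg -/(luxset q x); have [->|/set0P s0] := eqVneq (luxset q x) set0.
  by rewrite inf0.
by apply: lb_le_inf => // l [/ltW].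
Qed.

Lemma luxemburg_le q x l : 0 < l ->
  (modular q (fun k => (x k / l)%R) <= 1)%E -> luxemburg q x <= l.
Proof. by move=> l0 xl; apply: ge_inf; [exists 0 => m [/ltW]|split]. Qed.

Lemma le_luxemburg q x (m : R) : in_lspace q x ->
  (forall l, 0 < l -> (modular q (fun k => (x k / l)%R) <= 1)%E -> m <= l) ->
  m <= luxemburg q x.
Proof.
move=> /luxemburg_has_inf[s0 _] h.
by apply: lb_le_inf => // l [l0 /(h _ l0)].
Qed.

Lemma norm_le_luxemburg q x k : in_lspace q x -> `|x k| <= luxemburg q x.
Proof.
move=> xq; apply: le_luxemburg => // l l0 /le_modular1/(_ k).
by rewrite normrM normfV (gtr0_norm l0) ler_pdivrMr// mul1r.
Qed.

Lemma modularD_le1 q x y (a b : R) : 0 < a -> 0 < b ->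
  (modular q (fun k => (x k / a)%R) <= 1)%E ->
  (modular q (fun k => (y k / b)%R) <= 1)%E ->
  (modular q (fun k => ((x k + y k) / (a + b))%R) <= 1)%E.
Proof.
move=> a0 b0 xa yb; have ab0 : 0 < a + b by rewrite addr_gt0.
have a0' := lt0r_neq0 a0; have b0' := lt0r_neq0 b0.
have ab0' := lt0r_neq0 ab0.
rewrite (_ : (fun k => _) =
    (fun k => a / (a + b) * (x k / a) + b / (a + b) * (y k / b))); last first.
  by apply/funext => k; field; rewrite a0' b0' ab0'.
apply: le_trans (modular_convex _ _ _ _ _ _) _.
- by rewrite divr_ge0 ?ltW.
- by rewrite divr_ge0 ?ltW.
- by rewrite -mulrDl divff.
have -> : 1%E = ((a / (a + b))%:E * 1 + (b / (a + b))%:E * 1)%E.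
  by rewrite !mule1 -EFinD -mulrDl divff.
by apply: leeD; rewrite lee_wpmul2l// lee_fin divr_ge0 ?ltW.
Qed.


Lemma in_lspaceP q x : in_lspace q x <->
  exists2 l : R, 0 < l & (modular q (fun k => (x k / l)%R) <= 1)%E.
Proof.
split=> [/luxemburg_has_inf[[l [l0 xl]] _]|[l l0 xl]]; exists l => //.
exact: le_lt_trans xl (ltry 1).
Qed.

Lemma in_lspace0 q : in_lspace q (fun=> 0).
Proof.
exists 1 => //; rewrite (_ : (fun k => _) = fun=> 0) ?modular0 ?ltry//.
by apply/funext => k; rewrite mul0r.
Qed.

Lemma in_lspaceD q x y : in_lspace q x -> in_lspace q y ->
  in_lspace q (fun k => x k + y k).
Proof.
move=> /in_lspaceP[a a0 xa] /in_lspaceP[b b0 yb]; apply/in_lspaceP.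
by exists (a + b); [exact: addr_gt0|exact: modularD_le1].
Qed.

Lemma modular_scale q x (c l : R) : c != 0 ->
  modular q (fun k => c * x k / (`|c| * l)) = modular q (fun k => x k / l).
Proof.
move=> c0; apply: modular_norm => k.
have c0' : `|c| != 0 by rewrite normr_eq0.
by rewrite invfM !normrM !normfV normr_id mulrACA divff ?mul1r.
Qed.

Lemma in_lspaceZ q x c : in_lspace q x -> in_lspace q (fun k => c * x k).
Proof.
have [->|c0] := eqVneq c 0.
  move=> _; rewrite (_ : (fun k => _) = fun=> 0); first exact: in_lspace0.
  by apply/funext => k; rewrite mul0r.
move=> [l l0 xl]; exists (`|c| * l); first by rewrite mulr_gt0 ?normr_gt0.
by rewrite modular_scale.
Qed.

Lemma luxemburgD q x y : in_lspace q x -> in_lspace q y ->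
  luxemburg q (fun k => x k + y k) <= luxemburg q x + luxemburg q y.
Proof.
move=> xq yq; rewrite -lerBlDr; apply: le_luxemburg => // a a0 xa.
rewrite lerBlDr -lerBlDl; apply: le_luxemburg => // b b0 yb.
rewrite lerBlDl; apply: luxemburg_le; first exact: addr_gt0.
exact: modularD_le1.
Qed.

Lemma luxemburgZ_le q x c : c != 0 -> in_lspace q x ->
  luxemburg q (fun k => c * x k) <= `|c| * luxemburg q x.
Proof.
move=> c0 xq; have c0' : 0 < `|c| by rewrite normr_gt0.
rewrite -ler_pdivrMl//; apply: le_luxemburg => // l l0 xl.
by rewrite ler_pdivrMl//; apply: luxemburg_le; rewrite ?mulr_gt0 ?modular_scale.
Qed.

Lemma luxemburg0 q : luxemburg q (fun=> 0) = 0.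
Proof.
apply/eqP; rewrite eq_le luxemburg_ge0 andbT.
apply/ler_addgt0Pr => e e0; rewrite add0r; apply: luxemburg_le => //.
rewrite (_ : (fun k => _) = fun=> 0) ?modular0//.
by apply/funext => k; rewrite mul0r.
Qed.

Lemma luxemburgZ q x c : in_lspace q x ->
  luxemburg q (fun k => c * x k) = `|c| * luxemburg q x.
Proof.
move=> xq; have [->|c0] := eqVneq c 0.
  rewrite normr0 mul0r (_ : (fun k => _) = fun=> 0); first exact: luxemburg0.
  by apply/funext => k; rewrite mul0r.
apply/eqP; rewrite eq_le luxemburgZ_le//=.
rewrite -ler_pdivlMl ?normr_gt0// -normfV.
have := luxemburgZ_le (invr_neq0 c0) (in_lspaceZ c xq).
by rewrite (_ : (fun k => _) = x)//; apply/funext => k; rewrite mulKf.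
Qed.

End modular.

Section lspace.
Context {R : realType} (q : exponent R).

Definition lspace_pred : {pred nat -> R^o} := [pred x | `[< in_lspace q x >]].

Lemma lspace_submod_closed : submod_closed lspace_pred.
Proof.
split; first exact/asboolP/in_lspace0.
move=> c x y /asboolP xq /asboolP yq; apply/asboolP.
exact: in_lspaceD (in_lspaceZ c xq) yq.
Qed.

HB.instance Definition _ := GRing.isSubmodClosed.Build R (nat -> R^o)
  lspace_pred lspace_submod_closed.

Record lspace := Lspace {
  lspace_fun :> nat -> R^o ;
  lspace_funP : lspace_fun \in lspace_pred }.

HB.instance Definition _ := [isSub for lspace_fun].
HB.instance Definition _ := [Choice of lspace by <:].
HB.instance Definition _ := [SubChoice_isSubLmodule of lspace by <:].

Lemma lspaceP (x : lspace) : in_lspace q x.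
Proof. by have /asboolP := lspace_funP x. Qed.

Definition lspace_norm (x : lspace) : R := luxemburg q x.

Lemma lspace_normD x y :
  lspace_norm (x + y) <= lspace_norm x + lspace_norm y.
Proof. by apply: luxemburgD; exact: lspaceP. Qed.

Lemma lspace_normZ c x : lspace_norm (c *: x) = `|c| * lspace_norm x.
Proof. by apply: luxemburgZ; exact: lspaceP. Qed.

Lemma lspace_norm0_eq0 x : lspace_norm x = 0 -> x = 0.
Proof.
move=> x0; apply/val_inj/funext => k; apply/eqP; rewrite -normr_le0.
by rewrite -x0 norm_le_luxemburg//; exact: lspaceP.
Qed.

HB.instance Definition _ := Lmodule_isNormed.Build R lspace
  lspace_normD lspace_normZ lspace_norm0_eq0.

Lemma lspace_normE (x : lspace) : `|x| = luxemburg q x.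
Proof. by []. Qed.

End lspace.

Section dual.
Context {R : realType} (V : normedModType R).

Definition dual_pred : {pred V -> R^o} :=
  [pred f : V -> R^o | `[< linear f /\ continuous f >]].

Lemma dual_submod_closed : submod_closed dual_pred.
Proof.
split.
  apply/asboolP; split; last by move=> x; exact: cst_continuous.
  by move=> a u v; rewrite /= scaler0 addr0.
move=> c f g /asboolP[lf cf] /asboolP[lg cg]; apply/asboolP; split.
  move=> a u v; rewrite !fctE lf lg !scalerDr !scalerA (mulrC c).
  by rewrite addrACA.
move=> x; apply: continuousD; last exact: cg.
by apply: cvgZl_tmp; exact: cf.
Qed.

HB.instance Definition _ := GRing.isSubmodClosed.Build R (V -> R^o)
  dual_pred dual_submod_closed.

Record dual := Dual {
  dual_fun :> V -> R^o ;
  dual_funP : dual_fun \in dual_pred }.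

HB.instance Definition _ := [isSub for dual_fun].
HB.instance Definition _ := [Choice of dual by <:].
HB.instance Definition _ := [SubChoice_isSubLmodule of dual by <:].

Lemma dual_linear (f : dual) : linear f.
Proof. by have /asboolP[] := dual_funP f. Qed.

HB.instance Definition _ (f : dual) :=
  GRing.isLinear.Build R V R^o *:%R f (dual_linear f).

Lemma dual_continuous (f : dual) : continuous f.
Proof. by have /asboolP[] := dual_funP f. Qed.

Definition dual_norm (f : dual) : R :=
  sup [set (`|f v| : R) | v in [set v : V | `|v| <= 1]].

Lemma dual_has_sup (f : dual) :
  has_sup [set (`|f v| : R) | v in [set v : V | `|v| <= 1]].
Proof.
split; first by exists `|f 0|, 0 => //=; rewrite normr0 ler01.
have /linear_boundedP := continuous_linear_bounded 0 (@dual_continuous f 0).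
move=> /pinfty_ex_gt0[M M0 fM]; exists M => _ [v /= v1 <-].
by rewrite (le_trans (fM v))// ler_piMr// ltW.
Qed.

Lemma dual_norm_ge0 (f : dual) : 0 <= dual_norm f.
Proof.
apply: le_trans (ub_le_sup (dual_has_sup f).2 _); first exact: (normr_ge0 (f 0)).
by exists 0 => //=; rewrite normr0 ler01.
Qed.

Lemma dual_norm_le (f : dual) v : `|f v| <= dual_norm f * `|v|.
Proof.
have [->|v0] := eqVneq v 0; first by rewrite linear0 !normr0 mulr0.
have v0' : 0 < `|v| by rewrite normr_gt0.
rewrite -ler_pdivrMr// mulrC -(@gtr0_norm _ `|v|^-1) ?invr_gt0// -normrM.
rewrite -[_ * f v]/(_ *: f v) -linearZ; apply: ub_le_sup.
  exact: (dual_has_sup f).2.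
exists (`|v|^-1 *: v) => //=.
by rewrite normrZ gtr0_norm ?invr_gt0// mulVf ?gt_eqF.
Qed.

Lemma dual_norm_lub (f : dual) M :
  (forall v, `|v| <= 1 -> `|f v| <= M) -> dual_norm f <= M.
Proof.
move=> fM; apply: ge_sup; first exact: (dual_has_sup f).1.
by move=> _ [v /= v1 <-]; exact: fM.
Qed.

Lemma dual_normD f g : dual_norm (f + g) <= dual_norm f + dual_norm g.
Proof.
apply: dual_norm_lub => v v1; rewrite -[(f + g) v]/(f v + g v).
rewrite (le_trans (ler_normD _ _))// lerD//.
  by rewrite (le_trans (dual_norm_le f v))// ler_piMr// dual_norm_ge0.
by rewrite (le_trans (dual_norm_le g v))// ler_piMr// dual_norm_ge0.
Qed.

Lemma dual_normZ c f : dual_norm (c *: f) = `|c| * dual_norm f.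
Proof.
have h a h : dual_norm (a *: h) <= `|a| * dual_norm h.
  apply: dual_norm_lub => v v1; rewrite -[(a *: h) v]/(a * h v) normrM.
  rewrite ler_wpM2l// (le_trans (dual_norm_le h v))//.
  by rewrite ler_piMr// dual_norm_ge0.
apply/eqP; rewrite eq_le h /=; have [->|c0] := eqVneq c 0.
  by rewrite normr0 mul0r dual_norm_ge0.
rewrite -ler_pdivlMl ?normr_gt0// -normfV.
by have := h c^-1 (c *: f); rewrite scalerA mulVf// scale1r.
Qed.

Lemma dual_norm0_eq0 f : dual_norm f = 0 -> f = 0.
Proof.
move=> f0; apply/val_inj/funext => v; apply/eqP; rewrite -normr_le0.
by have := dual_norm_le f v; rewrite f0 mul0r.
Qed.

HB.instance Definition _ := Lmodule_isNormed.Build R dual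
  dual_normD dual_normZ dual_norm0_eq0.

Lemma dual_normE (f : dual) :
  `|f| = sup [set (`|f v| : R) | v in [set v : V | `|v| <= 1]].
Proof. by []. Qed.

End dual.

Section closure_quotient.
Context {R : realType} {V : normedModType R} (S : submodClosed V).

Definition closure_pred : {pred V} :=
  [pred x | `[< closure [set y | y \in (S : {pred V})] x >]].

Lemma closure_predP x : reflect
  (forall e : R, 0 < e -> exists2 y, y \in (S : {pred V}) & `|x - y| < e)
  (x \in closure_pred).
Proof.
apply: (iffP (asboolP _)) => [cx e e0|h A].
  have /cx[y [Sy]] := @nbhsx_ballx _ _ x e e0.
  by rewrite -ball_normE => xy; exists y.
rewrite -nbhs_ballE => -[e /= e0 eA]; have [y Sy xy] := h e e0.
by exists y; split => //; apply: eA; rewrite -ball_normE.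
Qed.

Lemma closure_submod_closed : submod_closed closure_pred.
Proof.
split.
  by apply/closure_predP => e e0; exists 0; rewrite ?rpred0// subrr normr0.
move=> c x y /closure_predP Sx /closure_predP Sy; apply/closure_predP => e e0.
have c0 : 0 < `|c| + 1 by rewrite ltr_wpDl.
have e2 : 0 < e / 2 by rewrite divr_gt0.
have [u Su xu] := Sx (e / 2 / (`|c| + 1)) (divr_gt0 e2 c0).
have [v Sv yv] := Sy (e / 2) e2.
exists (c *: u + v); first by rewrite rpredD// rpredZ.
rewrite opprD addrACA -scalerBr (le_lt_trans (ler_normD _ _))//.
rewrite (splitr e) ler_ltD// normrZ.
rewrite (@le_trans _ _ ((`|c| + 1) * `|x - u|)) ?ler_wpM2r ?lerDl//.
by rewrite mulrC -ler_pdivlMr// ltW.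
Qed.

HB.instance Definition _ := GRing.isSubmodClosed.Build R V
  closure_pred closure_submod_closed.

Local Open Scope quotient_scope.

Definition closure_quot := {ideal_quot closure_pred}.

HB.instance Definition _ := GRing.Zmodule.on closure_quot.

Definition closure_pi : V -> closure_quot := \pi_{ideal_quot closure_pred}.

Lemma closure_piP x y :
  reflect (closure_pi x = closure_pi y) (x - y \in closure_pred).
Proof. by rewrite Quotient.idealrBE; exact: eqP. Qed.

Lemma closure_pi_surj u : exists x, closure_pi x = u.
Proof. by exists (repr u); exact: reprK. Qed.

Lemma closure_piD x y : closure_pi (x + y) = closure_pi x + closure_pi y.
Proof. by rewrite /closure_pi raddfD. Qed.

Lemma closure_pi_eq0 x : (closure_pi x = 0) <-> (x \in closure_pred).
Proof.
have <- : closure_pi 0 = 0 by rewrite /closure_pi raddf0.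
by rewrite -{2}(subr0 x); split => /closure_piP.
Qed.

Definition closure_scale (c : R) (u : closure_quot) : closure_quot :=
  closure_pi (c *: repr u).

Lemma closure_piZ c x : closure_scale c (closure_pi x) = closure_pi (c *: x).
Proof.
apply/closure_piP; rewrite -scalerBr rpredZ//; apply/closure_piP.
exact: reprK.
Qed.

Let scaleA a b u : closure_scale a (closure_scale b u) = closure_scale (a * b) u.
Proof.
by have [x <-] := closure_pi_surj u; rewrite !closure_piZ scalerA.
Qed.

Let scale1 u : closure_scale 1 u = u.
Proof. by have [x <-] := closure_pi_surj u; rewrite closure_piZ scale1r. Qed.

Let scaleDr : right_distributive closure_scale +%R.
Proof.
move=> c u v; have [x <-] := closure_pi_surj u.
have [y <-] := closure_pi_surj v.
by rewrite -closure_piD !closure_piZ scalerDr closure_piD.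
Qed.

Let scaleDl u : {morph closure_scale^~ u : a b / a + b}.
Proof.
move=> a b; have [x <-] := closure_pi_surj u.
by rewrite !closure_piZ scalerDl closure_piD.
Qed.

HB.instance Definition _ := GRing.Zmodule_isLmodule.Build R closure_quot
  scaleA scale1 scaleDr scaleDl.

Definition quot_norm (u : closure_quot) : R :=
  inf [set `|x| | x in [set x | closure_pi x = u]].

Lemma quot_norm_has_inf u : has_inf [set `|x| | x in [set x | closure_pi x = u]].
Proof.
split; last by exists 0 => _ [x _ <-].
by have [x xu] := closure_pi_surj u; exists `|x|, x.
Qed.

Lemma quot_norm_le x : quot_norm (closure_pi x) <= `|x|.
Proof. by apply: ge_inf; [exact: (quot_norm_has_inf _).2|exists x]. Qed.

Lemma le_quot_norm u M : (forall x, closure_pi x = u -> M <= `|x|) ->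
  M <= quot_norm u.
Proof.
move=> uM; apply: lb_le_inf; first exact: (quot_norm_has_inf _).1.
by move=> _ [x /= xu <-]; exact: uM.
Qed.

Lemma quot_norm_ge0 u : 0 <= quot_norm u.
Proof. by apply: le_quot_norm. Qed.

Lemma quot_normD u v : quot_norm (u + v) <= quot_norm u + quot_norm v.
Proof.
rewrite -lerBlDr; apply: le_quot_norm => x xu.
rewrite lerBlDr -lerBlDl; apply: le_quot_norm => y yv.
rewrite lerBlDl -xu -yv -closure_piD.
by rewrite (le_trans (quot_norm_le _))// ler_normD.
Qed.

Lemma quot_normZ c u : quot_norm (c *: u) = `|c| * quot_norm u.
Proof.
have h a v : a != 0 -> quot_norm (a *: v) <= `|a| * quot_norm v.
  move=> a0; rewrite -ler_pdivrMl ?normr_gt0//; apply: le_quot_norm => x <-.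
  rewrite ler_pdivrMl ?normr_gt0// -normrZ.
  by rewrite [_ *: _](closure_piZ a x) quot_norm_le.
have [->|c0] := eqVneq c 0.
  rewrite scale0r normr0 mul0r; apply/eqP; rewrite eq_le quot_norm_ge0 andbT.
  by have := quot_norm_le 0; rewrite normr0 (closure_pi_eq0 0).2// rpred0.
apply/eqP; rewrite eq_le h//= -ler_pdivlMl ?normr_gt0// -normfV.
by have := h c^-1 (c *: u) (invr_neq0 c0); rewrite scalerA mulVf// scale1r.
Qed.

Lemma quot_norm0_eq0 u : quot_norm u = 0 -> u = 0.
Proof.
have [x <-] := closure_pi_surj u => x0; apply/closure_pi_eq0.
apply/closure_predP => e e0.
have [_ [y /= yx <-]] := inf_adherent e0 (quot_norm_has_inf (closure_pi x)).
rewrite -/(quot_norm _) x0 add0r => ye.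
have e2 : 0 < e - `|y| by rewrite subr_gt0.
have /closure_piP/closure_predP/(_ _ e2)[z Sz xyz] := esym yx.
exists z => //; have -> : x - z = x - y - z + y.
  by rewrite [RHS]addrAC subrK.
by rewrite (le_lt_trans (ler_normD _ _))// -ltrBrDr.
Qed.

HB.instance Definition _ := Lmodule_isNormed.Build R closure_quot
  quot_normD quot_normZ quot_norm0_eq0.

Lemma quot_normE (u : closure_quot) :
  `|u| = inf [set `|x| | x in [set x | closure_pi x = u]].
Proof. by []. Qed.

End closure_quotient.

Section germ.
Context {R : realType} (q : exponent R).

Definition bounded_support_pred : {pred lspace q} :=
  [pred x : lspace q |
    `[< exists M : R, forall k, x k != 0 -> (q k <= M%:E)%E >]].

Lemma bounded_support_submod_closed : submod_closed bounded_support_pred.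
Proof.
split; first by apply/asboolP; exists 0 => k /eqP[].
move=> c x y /asboolP[M xM] /asboolP[N yN]; apply/asboolP.
exists (Num.max M N) => k xyk.
have [xk|xk] := eqVneq (x k) 0; last first.
  by rewrite (le_trans (xM _ xk))// lee_fin le_max lexx.
have [yk|yk] := eqVneq (y k) 0; last first.
  by rewrite (le_trans (yN _ yk))// lee_fin le_max lexx orbT.
by move: xyk; rewrite -[_ k]/(c * x k + y k) xk yk mulr0 addr0 eqxx.
Qed.

HB.instance Definition _ := GRing.isSubmodClosed.Build R (lspace q)
  bounded_support_pred bounded_support_submod_closed.

Definition germ := closure_quot bounded_support_pred.

HB.instance Definition _ := NormedModule.on germ.

Lemma germ_normE (u : germ) :
  `|u| = inf [set `|x| | x in [set x | closure_pi _ x = u]].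
Proof. by []. Qed.

End germ.

Section pba.
Context {R : realType}.
Implicit Types (mu nu : set nat -> R) (A B E : set nat).

Definition finitely_additive mu : Prop :=
  forall A B, A `&` B = set0 -> mu (A `|` B) = mu A + mu B.

(* Disjoint families need not cover E: adding the remaining part only
   increases the sum, so this is also the supremum over finite partitions. *)
Definition total_variation mu E : \bar R :=
  ereal_sup [set s : \bar R | exists (n : nat) (F : 'I_n -> set nat),
    [/\ trivIset setT F, forall i, F i `<=` E &
        s = (\sum_(i < n) `|mu (F i)|)%:E]].

Definition pba_pred : {pred set nat -> R^o} :=
  [pred mu : set nat -> R^o | `[< [/\ finitely_additive mu,
    (total_variation mu setT < +oo)%E &
    forall E, finite_set E -> mu E = 0] >]].

Lemma total_variation_ge0 mu E : (0 <= total_variation mu E)%E.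
Proof.
apply: ereal_sup_ubound; exists 0%N, (fun=> set0).
by split; [apply/trivIsetP => -[]|case|rewrite big_ord0].
Qed.

Lemma total_variation0 E : total_variation (fun=> 0) E = 0%E.
Proof.
apply/eqP; rewrite eq_le total_variation_ge0 andbT.
apply: ge_ereal_sup => _ [n [F [_ _ ->]]].
by rewrite big1// => i _; rewrite normr0.
Qed.

Lemma total_variationD mu nu E :
  (total_variation (fun A => mu A + nu A)%R E
   <= total_variation mu E + total_variation nu E)%E.
Proof.
apply: ge_ereal_sup => _ [n [F [tF FE ->]]].
apply: (@le_trans _ _ ((\sum_(i < n) `|mu (F i)|)%:E
                       + (\sum_(i < n) `|nu (F i)|)%:E)%E).
  by rewrite -EFinD lee_fin -big_split/=; apply: ler_sum => i _; exact: ler_normD.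
by apply: leeD; apply: ereal_sup_ubound; exists n, F.
Qed.

Lemma total_variationZ_le mu c E :
  (total_variation (fun A => c * mu A)%R E <= `|c|%:E * total_variation mu E)%E.
Proof.
apply: ge_ereal_sup => _ [n [F [tF FE ->]]].
apply: (@le_trans _ _ (`|c|%:E * (\sum_(i < n) `|mu (F i)|)%:E)%E).
  by rewrite -EFinM lee_fin mulr_sumr; apply: ler_sum => i _; rewrite normrM.
by rewrite lee_wpmul2l ?lee_fin//; apply: ereal_sup_ubound; exists n, F.
Qed.

Lemma norm_le_total_variation mu E : (`|mu E|%:E <= total_variation mu E)%E.
Proof.
apply: ereal_sup_ubound; exists 1%N, (fun=> E); split.
- by apply/trivIsetP => i j _ _; rewrite !ord1 eqxx.
- by move=> i; exact: subset_refl.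
- by rewrite big_ord1.
Qed.

Lemma sub_total_variation mu A B : A `<=` B ->
  (total_variation mu A <= total_variation mu B)%E.
Proof.
move=> AB; apply: ge_ereal_sup => _ [n [F [tF FE ->]]].
by apply: ereal_sup_ubound; exists n, F; split => // i; exact: subset_trans AB.
Qed.

Lemma pba_submod_closed : submod_closed pba_pred.
Proof.
split.
  apply/asboolP; split => //; first by move=> A B _; rewrite addr0.
  by rewrite total_variation0 ltry.
move=> c mu nu /asboolP[amu fmu mu0] /asboolP[anu fnu nu0].
apply/asboolP; split.
- move=> A B AB; rewrite !fctE amu// anu// scalerDr.
  exact: addrACA.
- rewrite (le_lt_trans (total_variationD (fun A => c * mu A) nu _))//.
  rewrite lte_add_pinfty// (le_lt_trans (total_variationZ_le _ _ _))//.
  by rewrite lte_mul_pinfty ?lee_fin.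
- by move=> E fE; rewrite !fctE mu0// nu0// scaler0 addr0.
Qed.

HB.instance Definition _ := GRing.isSubmodClosed.Build R (set nat -> R^o)
  pba_pred pba_submod_closed.

End pba.

Section pba_space.
Context (R : realType).

Record pba := Pba {
  pba_fun :> set nat -> R^o ;
  pba_funP : pba_fun \in pba_pred }.

HB.instance Definition _ := [isSub for pba_fun].
HB.instance Definition _ := [Choice of pba by <:].
HB.instance Definition _ := [SubChoice_isSubLmodule of pba by <:].

Definition pba_norm (mu : pba) : R := fine (total_variation mu setT).

Lemma pba_normE (mu : pba) : (pba_norm mu)%:E = total_variation mu setT.
Proof.
have /asboolP[_ fmu _] := pba_funP mu.
by rewrite fineK// ge0_fin_numE// total_variation_ge0.
Qed.

Lemma pba_norm_ge0 mu : 0 <= pba_norm mu.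
Proof. by rewrite -lee_fin pba_normE total_variation_ge0. Qed.

Lemma pba_normD mu nu : pba_norm (mu + nu) <= pba_norm mu + pba_norm nu.
Proof. by rewrite -lee_fin EFinD !pba_normE; exact: total_variationD. Qed.

Lemma pba_normZ c mu : pba_norm (c *: mu) = `|c| * pba_norm mu.
Proof.
have h a nu : pba_norm (a *: nu) <= `|a| * pba_norm nu.
  by rewrite -lee_fin EFinM !pba_normE; exact: total_variationZ_le.
apply/eqP; rewrite eq_le h/=; have [->|c0] := eqVneq c 0.
  by rewrite normr0 mul0r pba_norm_ge0.
rewrite -ler_pdivlMl ?normr_gt0// -normfV.
by have := h c^-1 (c *: mu); rewrite scalerA mulVf// scale1r.
Qed.

Lemma pba_norm0_eq0 mu : pba_norm mu = 0 -> mu = 0.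
Proof.
move=> mu0; apply/val_inj/funext => E; apply/eqP; rewrite -normr_le0.
rewrite -lee_fin -mu0 pba_normE.
exact: le_trans (norm_le_total_variation _ _) (sub_total_variation _ _).
Qed.

HB.instance Definition _ := Lmodule_isNormed.Build R pba
  pba_normD pba_normZ pba_norm0_eq0.

Lemma pba_norm_variation (mu : pba) :
  `|mu|%:E = total_variation mu setT.
Proof. exact: pba_normE. Qed.

End pba_space.

Definition bounded_operator (R : realType) (V W : normedModType R)
    (f : V -> W) : Prop :=
  exists C : R, forall x, `|f x| <= C * `|x|.

Definition isomorphic (R : realType) (V W : normedModType R) : Prop :=
  exists (f : {linear V -> W}) (g : W -> V),
    [/\ cancel f g, cancel g f, bounded_operator f & bounded_operator g].

(* Main.v *)
Require Import Defs.
From HB Require Import structures.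
From mathcomp Require Import all_boot all_order all_algebra.
From mathcomp Require Import ring lra.
From mathcomp Require Import all_classical all_reals all_analysis.

(* The summability of B^(-p(k)) makes l^p(.) equal to l^oo and l^p'(.) equal to
   l^1, with equivalent norms: the modular of a sequence bounded by 1/B is at
   most the given sum, and Young's inequality for B^-1 * |y(k)| gives
   |y(k)| <= B (|y(k)|^p'(k) + B^(-p(k))).  A functional phi on l^oo is
   determined by the finitely additive measure E |-> phi(1_E), because step
   functions are dense.  Subtracting the countably additive part
   E |-> sum_(k in E) phi(e_k) leaves a purely finitely additive measure, so
   that phi |-> ((phi(e_k))_k, singular part) is the isomorphism.  It is onto
   because bounded sequences can be integrated against finitely additive
   measures.  Moreover p(k) tends to infinity, so the sequences on whose support
   p is bounded are the finitely supported ones, and a functional factors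
   through the germ space exactly when it vanishes on all e_k. *)

Set Implicit Arguments.
Unset Strict Implicit.
Unset Printing Implicit Defensive.

Import Order.TTheory GRing.Theory Num.Theory.
Import numFieldNormedType.Exports.

Local Open Scope classical_set_scope.
Local Open Scope ring_scope.

(** * Integration against finitely additive measures *)

Section partition_code.

(* Two points have the same code iff they belong to the same sets of [L], so the
   fibers of [code L] are the atoms of the algebra generated by [L]. *)
Fixpoint code (L : seq (set nat)) (k : nat) : nat :=
  if L is E :: L' then ((code L' k).*2 + (k \in E))%N else 0%N.

Lemma code_lt L k : (code L k < 2 ^ size L)%N.
Proof.
elim: L => //= E L IH; rewrite expnS mul2n.
case: (k \in E); rewrite /= ?addn1 ?addn0 ?ltn_double//.
by rewrite -doubleS leq_double.
Qed.

Lemma code_inj_mem L E k j : E \in L -> code L k = code L j ->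
  (k \in E) = (j \in E).
Proof.
elim: L => //= F L IH; rewrite inE => EL kj.
have kjF : (k \in F) = (j \in F).
  by have := congr1 odd kj; rewrite !oddD !odd_double /= !oddb.
case/predU1P: EL => [->//|EL]; apply: IH => //.
by move: kj; rewrite kjF => /addIn /double_inj.
Qed.

(* Refining [L] refines the partition into fibers of [code L]; an ultrafilter
   containing all refinements replaces the proof that the Riemann sums are
   Cauchy. *)
Lemma fine_partition_ultrafilter : exists U : set_system (seq (set nat)),
  UltraFilter U /\
  forall L0 : seq (set nat), U [set L : seq (set nat) | {subset L0 <= L}].
Proof.
pose F := filter_from [set: seq (set nat)]
  (fun L0 => [set L : seq (set nat) | {subset L0 <= L}]).
have FF : ProperFilter F.
  apply: filter_from_proper; last by move=> L0 _; exists L0.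
  apply: filter_from_filter; first by exists [::].
  move=> L1 L2 _ _; exists (L1 ++ L2) => // L /= sL; split => E EL.
    by apply: sL; rewrite mem_cat EL.
  by apply: sL; rewrite mem_cat EL orbT.
have [U [UU FU]] := ultraFilterLemma FF.
by exists U; split => // L0; apply: FU; exists L0.
Qed.

End partition_code.

Section finitely_additive_integral.
Context {R : realType}.
Implicit Types (mu : set nat -> R) (x y : nat -> R).

Lemma finitely_additive0 mu : finitely_additive mu -> mu set0 = 0.
Proof. by move=> /(_ set0 set0); rewrite setI0 setU0 => /(_ erefl); lra. Qed.

Lemma finitely_additive_fibers mu (g : nat -> nat) n E :
  finitely_additive mu -> (forall k, g k < n)%N ->
  \sum_(i < n) mu (E `&` g @^-1` [set (i : nat)]) = mu E.
Proof.
move=> addmu gn.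
(* Additivity is given for two sets only, so the fibers are merged one at a time. *)
suff H m : \sum_(i < m) mu (E `&` g @^-1` [set (i : nat)]) =
    mu (E `&` [set k | (g k < m)%N]).
  by rewrite H; congr mu; apply/seteqP; split => [k []//|k Ek]; split => //=.
elim: m => [|m IH].
  rewrite big_ord0 (_ : _ `&` _ = set0) ?finitely_additive0//.
  by apply/seteqP; split => // k [].
rewrite big_ord_recr /= IH -addmu.
  congr mu; apply/seteqP; split => [k [[Ek /= km]|[Ek /= ->]]|k [Ek /=]].
  - by split => //=; exact: ltnW.
  - by split => /=.
  - by rewrite ltnS leq_eqVlt => /predU1P[km|km]; [right|left]; split.
by apply/seteqP; split => // k [[_ /= km] [_ /= kE]]; rewrite kE ltnn in km.
Qed.

(* When a fiber is empty, [xget] returns the junk tag 0, but the measure of the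
   fiber is then 0. *)
Definition riemann_sum mu x (L : seq (set nat)) : R :=
  \sum_(i < 2 ^ size L) x (xget 0%N (code L @^-1` [set (i : nat)])) *
    mu (code L @^-1` [set (i : nat)]).

(** The fibers of [code L] are disjoint, so they compete in the supremum that defines the total
    variation. The bound is uniform in [L], which gives convergence along the ultrafilter. *)
Lemma riemann_sum_le mu x L (M : R) : (Defs.total_variation mu setT < +oo)%E ->
  (forall k, `|x k| <= M) ->
  `|riemann_sum mu x L| <= M * fine (Defs.total_variation mu setT).
Proof.
move=> fmu xM; rewrite (le_trans (ler_norm_sum _ _ _))//.
have M0 : 0 <= M by exact: le_trans (xM 0%N).
apply: (@le_trans _ _ (M * \sum_(i < 2 ^ size L)
    `|mu (code L @^-1` [set (i : nat)])|)).
  by rewrite mulr_sumr; apply: ler_sum => i _; rewrite normrM ler_wpM2r.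
rewrite ler_wpM2l// -lee_fin fineK ?ge0_fin_numE ?Defs.total_variation_ge0//.
apply: ereal_sup_ubound; exists (2 ^ size L)%N,
  (fun i => code L @^-1` [set i : nat]).
split=> [|i k //|//]; apply/trivIsetP => i j _ _ ij.
apply/seteqP; split => // k [/= -> /=].
by move=> /val_inj ji; rewrite ji eqxx in ij.
Qed.

(** Each fiber lies inside [A] or misses it, because [A] is in [L]. The tag decides which, so the
    sum is exact already before the limit. *)
Lemma riemann_sum_indic mu L A : finitely_additive mu -> A \in L ->
  riemann_sum mu (\1_A) L = mu A.
Proof.
move=> addmu AL.
rewrite -[RHS](finitely_additive_fibers A addmu (code_lt L)).
apply: eq_bigr => i _; set C := code L @^-1` _.
have [C0|] := eqVneq C set0.
  by rewrite C0 setI0 finitely_additive0// mulr0.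
move=> /set0P [k0 Ck0]; have := @xgetPex _ 0%N C (ex_intro _ _ Ck0).
set t := xget _ _ => Ct.
have CA k : C k -> (k \in A) = (t \in A).
  by move=> Ck; apply: (@code_inj_mem L) => //; rewrite Ct Ck.
rewrite indicE; case: (boolP (t \in A)) => tA /=.
  rewrite mul1r; congr mu; apply/seteqP; split => [k Ck|k []//].
  by split => //; apply/set_mem; rewrite CA.
rewrite mul0r (_ : _ `&` _ = set0) ?finitely_additive0//.
by apply/seteqP; split => // k [/mem_set Ak Ck]; rewrite CA// (negbTE tA) in Ak.
Qed.

(** The values stay in the compact segment from [- K] to [K], where every ultrafilter converges. *)
Lemma ultrafilter_bounded_cvg (T : Type) (U : set_system T) (u : T -> R)
    (K : R) :
  UltraFilter U -> (forall t, `|u t| <= K) -> cvg (u @ U).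
Proof.
move=> UU uK.
have := @segment_compact R (- K) K; rewrite compact_ultra => /(_ (u @ U)).
(* The image filter is again maximal: if a set of a larger filter [G] had its preimage outside [U],
   its complement would be in [G] too. *)
have UuU : UltraFilter (u @ U).
  split; first exact: fmap_proper_filter.
  move=> G GG UG; apply/seteqP; split => // A GA.
  have [//|nUA] := pselect (U (u @^-1` A)).
  have : U (~` (u @^-1` A)).
    by have [|//] := in_ultra_setVsetC (u @^-1` A) UU.
  move=> /(UG (~` A)) GnA.
  by have /filter_ex[a []] : G (A `&` ~` A) by exact: filterI.
case=> //; last by move=> l [_ ul]; apply/cvg_ex; exists l.
rewrite /fmap/=; apply: filterS filterT => t _ /=.
by rewrite in_itv/= -ler_norml.
Qed.

(** [I] is the limit of the Riemann sums along the ultrafilter. Boundedness ensures that this limit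
    exists, and linearity and the norm bound pass to it. *)
Lemma finitely_additive_integral mu :
  finitely_additive mu -> (Defs.total_variation mu setT < +oo)%E ->
  exists I : (nat -> R) -> R, [/\
    forall c x y, (exists M, forall k, `|x k| <= M) ->
      (exists M, forall k, `|y k| <= M) ->
      I (fun k => c * x k + y k) = c * I x + I y,
    forall M x, (forall k, `|x k| <= M) ->
      `|I x| <= M * fine (Defs.total_variation mu setT) &
    forall A, I (\1_A) = mu A].
Proof.
move=> addmu fmu.
have [U [UU UL]] := fine_partition_ultrafilter.
have cvgU x : (exists M, forall k, `|x k| <= M) -> cvg (riemann_sum mu x @ U).
  move=> [M xM]; apply: ultrafilter_bounded_cvg => L.
  exact: riemann_sum_le fmu xM.
exists (fun x => lim (riemann_sum mu x @ U)); split.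
- move=> c x y bx by_; apply: cvg_lim => //.
  rewrite (_ : riemann_sum _ _ = c \*: riemann_sum mu x \+
      riemann_sum mu y); last first.
    apply/funext => L /=; rewrite /riemann_sum scaler_sumr -big_split/=.
    by apply: eq_bigr => i _; rewrite mulrDl -mulrA.
  by apply: cvgD; [apply: cvgZl_tmp|]; exact: cvgU.
- move=> M x xM; have cx := cvgU x (ex_intro _ M xM).
  rewrite -lim_norm//; apply: limr_le; first exact: is_cvg_norm.
  by apply: nearW => L; exact: riemann_sum_le.
- move=> A; apply: cvg_lim => //; apply: cvg_near_cst.
  (* The ultrafilter contains the set of all [L] with [A] in [L], and there the sums are
     constant. *)
  apply: filterS (UL [:: A]) => L /= sL.
  by rewrite riemann_sum_indic// sL// inE.
Qed.

End finitely_additive_integral.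

(** * Bounded functionals and absolutely summable sequences *)

Section bounded_functionals.
Context {R : realType}.

Lemma mem_dual (V : normedModType R) (f : V -> R^o) (C : R) : linear f ->
  (forall v, `|f v| <= C * `|v|) -> f \in @dual_pred R V.
Proof.
move=> lf fC; apply/asboolP; split=> //.
pose g : {linear V -> R^o} := HB.pack f (GRing.isLinear.Build _ _ _ _ f lf).
apply: (@bounded_linear_continuous _ _ _ g); apply/linear_boundedP.
apply: filterS (nbhs_pinfty_ge (num_real C)) => r Cr v.
by rewrite (le_trans (fC v))// ler_wpM2r.
Qed.

Lemma dual_norm_le_bound (V : normedModType R) (f : dual V) (C : R) : 0 <= C ->
  (forall v, `|f v| <= C * `|v|) -> `|f| <= C.
Proof.
move=> C0 fC; apply: dual_norm_lub => v v1.
by rewrite (le_trans (fC v))// ler_piMr.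
Qed.

(** Injectivity turns a choice of preimages into a two-sided inverse, and the norm control on the
    preimages bounds it. *)
Lemma isomorphic_of (V W : normedModType R) (f : {linear V -> W}) (C K : R) :
  (forall v, `|f v| <= K * `|v|) -> (forall v, f v = 0 -> v = 0) ->
  (forall w, exists v, f v = w /\ `|v| <= C * `|w|) ->
  isomorphic V W.
Proof.
move=> fK f0 /choice[g fg]; exists f, g; split.
- move=> v; apply/eqP; rewrite -subr_eq0; apply/eqP/f0.
  by rewrite linearB/= (fg _).1 subrr.
- by move=> w; rewrite (fg _).1.
- by exists K.
- by exists C => w; exact: (fg w).2.
Qed.

End bounded_functionals.

Section summable.
Context {R : realType}.
Implicit Types (a b x y : nat -> R) (q : exponent R).

(** The duality bracket of absolutely summable and bounded sequences. Absolute summability is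
    expressed below by a uniform bound on the partial sums of absolute values. *)
Definition pairing a x : R := limn (series (fun k => a k * x k)).

Lemma normed_series_pairing_le a x (M N : R) n :
  (forall n, \sum_(k < n) `|a k| <= M) -> (forall k, `|x k| <= N) ->
  [normed series (fun k => a k * x k)] n <= M * N.
Proof.
move=> aM xN; have N0 : 0 <= N by exact: le_trans (xN 0%N).
rewrite /= seriesEord/=; apply: (@le_trans _ _ (\sum_(k < n) `|a k| * N)).
  by apply: ler_sum => k _; rewrite normrM ler_wpM2l.
by rewrite -mulr_suml ler_wpM2r.
Qed.

Lemma is_cvg_normed_pairing a x (M N : R) :
  (forall n, \sum_(k < n) `|a k| <= M) -> (forall k, `|x k| <= N) ->
  cvgn [normed series (fun k => a k * x k)].
Proof.
move=> aM xN; apply: nondecreasing_is_cvgn.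
  by apply: nondecreasing_series => k _ _; exact: normr_ge0.
by exists (M * N) => _ [n _ <-]; exact: normed_series_pairing_le.
Qed.

Lemma pairing_le a x (M N : R) :
  (forall n, \sum_(k < n) `|a k| <= M) -> (forall k, `|x k| <= N) ->
  `|pairing a x| <= M * N.
Proof.
move=> aM xN; have cax := is_cvg_normed_pairing aM xN.
apply: le_trans (lim_series_norm cax) _; apply: limr_le => //.
by apply: nearW => n; exact: normed_series_pairing_le.
Qed.

Lemma pairing_linearr a x y c (M N N' : R) :
  (forall n, \sum_(k < n) `|a k| <= M) ->
  (forall k, `|x k| <= N) -> (forall k, `|y k| <= N') ->
  pairing a (fun k => c * x k + y k) = c * pairing a x + pairing a y.
Proof.
move=> aM xN yN; apply: cvg_lim => //.
rewrite (_ : series _ = c \*: series (fun k => a k * x k) \+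
    series (fun k => a k * y k)); last first.
  apply/funext => n /=; rewrite /series/= scaler_sumr -big_split/=.
  by apply: eq_bigr => k _; rewrite mulrDr mulrCA.
by apply: cvgD; [apply: cvgZl_tmp|];
  apply: normed_cvg; exact: is_cvg_normed_pairing.
Qed.

Lemma pairing_linearl a b x c (M M' N : R) :
  (forall n, \sum_(k < n) `|a k| <= M) ->
  (forall n, \sum_(k < n) `|b k| <= M') -> (forall k, `|x k| <= N) ->
  pairing (fun k => c * a k + b k) x = c * pairing a x + pairing b x.
Proof.
move=> aM bM xN; apply: cvg_lim => //.
rewrite (_ : series _ = c \*: series (fun k => a k * x k) \+
    series (fun k => b k * x k)); last first.
  apply/funext => n /=; rewrite /series/= scaler_sumr -big_split/=.
  by apply: eq_bigr => k _; rewrite mulrDl -mulrA.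
by apply: cvgD; [apply: cvgZl_tmp|];
  apply: normed_cvg; exact: is_cvg_normed_pairing.
Qed.

Lemma pairing_indic1 a j : pairing a (\1_[set j]) = a j.
Proof.
(* A partial sum up to [n] runs over indices below [n], so it contains the term at [j] from [j.+1]
   on. *)
apply: cvg_lim => //; apply: cvg_near_cst; exists j.+1 => // n /= jn.
rewrite seriesEord/= (bigD1 (Ordinal jn))//= big1 ?addr0.
  by rewrite indicE mem_set// mulr1.
move=> i ij; rewrite indicE memNset ?mulr0// => /= ijE.
by move: ij; rewrite -val_eqE/= ijE eqxx.
Qed.

(** A number in [[0, 1]] does not grow when raised to a power at least 1, so the sum is at most 1.
    The supremum over the infinite exponents contributes the other 1. *)
Lemma modular_summable q x : (forall n, \sum_(k < n) `|x k| <= 1) ->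
  (modular q x <= 2%:E)%E.
Proof.
move=> x1.
have xk1 k : `|x k| <= 1.
  apply: le_trans (x1 k.+1); rewrite big_ord_recr/= lerDr.
  by apply: sumr_ge0 => i _.
rewrite (_ : 2%:E = 1%:E + 1%:E)%E; last by rewrite -EFinD.
apply: leeD.
  apply: lime_le.
    by apply: is_cvg_nneseries => k _ _; rewrite lee_fin powR_ge0.
  apply: nearW => n; rewrite big_mkcond big_mkord.
  apply: (@le_trans _ _ (\sum_(k < n) `|x k|%:E)%E).
    apply: lee_sum => k _; case: ifPn => qk; rewrite ?lee_fin//.
    have [xk0|xk0] := eqVneq (x k) 0.
      rewrite xk0 normr0 powR0// gt_eqF// (lt_le_trans ltr01)//.
      exact: fine_exponent_ge1.
    rewrite -[leRHS](powRr1 (normr_ge0 (x k))).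
    apply: ger_powR; last exact: fine_exponent_ge1.
    by rewrite normr_gt0 xk0 xk1.
  by rewrite sumEFin lee_fin.
by apply: ge_ereal_sup => _ [->|[k _ <-]]; rewrite ?lee_fin.
Qed.

Lemma luxemburg_summable_gt0 q x (M : R) : 0 < M ->
  (forall n, \sum_(k < n) `|x k| <= M) ->
  in_lspace q x /\ luxemburg q x <= 2 * M.
Proof.
move=> M0 xM; have M20 : 0 < 2 * M by rewrite mulr_gt0.
suff H : (modular q (fun k => (x k / (2 * M))%R) <= 1)%E.
  by split; [apply/in_lspaceP; exists (2 * M)|exact: luxemburg_le].
(* Division by [M] normalizes the sum, and by convexity the factor [2^-1] halves the modular, which
   is at most 2. *)
rewrite (_ : (fun k => _) = (fun k => 2^-1 * (x k / M))); last first.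
  by apply/funext => k; field; rewrite gt_eqF.
apply: le_trans (modularZ_le _ _ _) _; first by apply/andP; split; lra.
apply: (@le_trans _ _ (2^-1%:E * 2%:E)%E).
  rewrite lee_wpmul2l ?lee_fin//; apply: modular_summable => n.
  under eq_bigr do rewrite normrM normfV (gtr0_norm M0).
  by rewrite -mulr_suml ler_pdivrMr// mul1r.
by rewrite -EFinM lee_fin; lra.
Qed.

Lemma luxemburg_summable q x (M : R) : (forall n, \sum_(k < n) `|x k| <= M) ->
  in_lspace q x /\ luxemburg q x <= 2 * M.
Proof.
move=> xM; have M0 : 0 <= M by have := xM 0%N; rewrite big_ord0.
(* [M] may be 0, so the positive case is applied to [M + e] for arbitrarily small [e]. *)
have H e : 0 < e -> forall n, \sum_(k < n) `|x k| <= M + e.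
  by move=> e0 n; rewrite (le_trans (xM n))// lerDl ltW.
split; first by case: (luxemburg_summable_gt0 q (ltr_wpDl M0 ltr01) (H _ ltr01)).
apply/ler_addgt0Pr => e e0; have e2 : 0 < e / 2 by rewrite divr_gt0.
have [_] := luxemburg_summable_gt0 q (ltr_wpDl M0 e2) (H _ e2).
by rewrite mulrDr mulrCA divff ?mulr1.
Qed.

End summable.

(** * The duals of the variable exponent spaces *)

Section spaces.
Context {R : realType} (p : nat -> R) (p_ge1 : forall k, 1 <= p k).
Context (B : R) (B_gt1 : 1 < B)
  (pB : (\sum_(0 <= k <oo) (B `^ (- p k))%:E < +oo)%E).

Local Notation q := (real_exponent p_ge1).
Local Notation q' := (dual_exponent (real_exponent p_ge1)).
Local Notation S := (fine (\sum_(0 <= k <oo) (B `^ (- p k))%:E)%E).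
Local Notation C := (B * (1 + S)).

Let B_gt0 : 0 < B. Proof. exact: lt_trans ltr01 B_gt1. Qed.

Let series_pB_ge0 : (0 <= \sum_(0 <= k <oo) (B `^ (- p k))%:E)%E.
Proof. by apply: nneseries_ge0 => k _ _; rewrite lee_fin powR_ge0. Qed.

Let S_ge0 : 0 <= S. Proof. exact: fine_ge0. Qed.

Let SE : (\sum_(0 <= k <oo) (B `^ (- p k))%:E)%E = S%:E.
Proof. by rewrite fineK// ge0_fin_numE. Qed.

Let S1_gt0 : 0 < 1 + S. Proof. by rewrite ltr_wpDr. Qed.

Let C_gt0 : 0 < C. Proof. by rewrite mulr_gt0. Qed.

Let C_ge0 : 0 <= C. Proof. exact: ltW. Qed.

Let sum_pB_le n : \sum_(k < n) B `^ (- p k) <= S.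
Proof.
rewrite -lee_fin -SE -sumEFin.
rewrite -(big_mkord xpredT (fun k => (B `^ (- p k))%:E)).
by apply: nneseries_lim_ge => k _ _; rewrite lee_fin powR_ge0.
Qed.

(** * Comparison with bounded and with summable sequences *)

Lemma modular_real x :
  modular q x = (\sum_(0 <= k <oo) (`|x k| `^ p k)%:E)%E.
Proof.
rewrite /modular (_ : [set k | _] = set0); last first.
  by apply/seteqP; split.
by rewrite image_set0 setU0 ereal_sup1 adde0; apply: eq_eseriesl.
Qed.

(** The two factors of [C] act in turn: division by [B * M] brings the modular down to at most [S],
    and then [1 + S], which is at least 1 as convexity requires, brings it below 1. *)
Lemma luxemburg_bounded_gt0 x (M : R) : 0 < M -> (forall k, `|x k| <= M) ->
  in_lspace q x /\ luxemburg q x <= C * M.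
Proof.
move=> M0 xM; have CM0 : 0 < C * M by rewrite mulr_gt0.
suff H : (modular q (fun k => (x k / (C * M))%R) <= 1)%E.
  by split; [apply/in_lspaceP; exists (C * M)|exact: luxemburg_le].
rewrite (_ : (fun k => _) = (fun k => (1 + S)^-1 * (x k / (B * M)))); last first.
  by apply/funext => k; field; rewrite !gt_eqF.
apply: le_trans (modularZ_le _ _ _) _.
  by rewrite invr_ge0 ltW//= invf_le1// lerDl.
apply: (@le_trans _ _ ((1 + S)^-1%:E * S%:E)%E); last first.
  by rewrite -EFinM lee_fin mulrC ler_pdivrMr// mul1r lerDr.
rewrite lee_wpmul2l ?lee_fin ?invr_ge0 ?(ltW S1_gt0)// modular_real -SE.
apply: lee_nneseries => [k _ _|k _]; first by rewrite lee_fin powR_ge0.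
rewrite lee_fin -mulN1r powRrM powR_inv1 ?(ltW B_gt0)//.
apply: ge0_ler_powR; rewrite ?nnegrE ?invr_ge0 ?(ltW B_gt0)// ?(le_trans ler01)//.
rewrite normrM normfV (gtr0_norm (mulr_gt0 _ _))// invfM mulrC -mulrA.
by rewrite ler_piMr ?invr_ge0 ?(ltW B_gt0)// mulrC ler_pdivrMr// mul1r.
Qed.

Lemma luxemburg_bounded x (M : R) : (forall k, `|x k| <= M) ->
  in_lspace q x /\ luxemburg q x <= C * M.
Proof.
move=> xM; have M0 : 0 <= M by exact: le_trans (xM 0%N).
have H e : 0 < e -> forall k, `|x k| <= M + e.
  by move=> e0 k; rewrite (le_trans (xM k))// lerDl ltW.
split; first by case: (luxemburg_bounded_gt0 (ltr_wpDl M0 ltr01) (H _ ltr01)).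
apply/ler_addgt0Pr => e e0; have e2 : 0 < e / C by rewrite divr_gt0.
have [_] := luxemburg_bounded_gt0 (ltr_wpDl M0 e2) (H _ e2).
by rewrite mulrDr mulrCA divff ?mulr1// gt_eqF.
Qed.

Lemma lspace_norm_bounded (v : lspace q) (M : R) :
  (forall k, `|v k| <= M) -> `|v| <= C * M.
Proof. by move=> vM; rewrite lspace_normE; exact: (luxemburg_bounded vM).2. Qed.

Lemma lspace_norm_ge (r : exponent R) (v : lspace r) k : `|v k| <= `|v|.
Proof. by rewrite lspace_normE norm_le_luxemburg//; exact: lspaceP. Qed.

Lemma indic_le1 (A : set nat) k : `|\1_A k| <= 1 :> R.
Proof. by rewrite indicE; case: (k \in A); rewrite ?normr1 ?normr0. Qed.

Definition indic_lspace (A : set nat) : lspace q :=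
  Defs.Lspace (asboolT (luxemburg_bounded (indic_le1 A)).1).

Lemma lspace_sumE n (c : 'I_n -> R) (F : 'I_n -> set nat) k :
  (\sum_(i < n) c i *: indic_lspace (F i)) k = \sum_(i < n) c i * \1_(F i) k.
Proof. by apply: (big_morph (fun v : lspace q => v k : R)). Qed.

(* Where p(k) = 1 the dual exponent is infinite and B * B^(-p(k)) = 1 alone is
   the bound; elsewhere this is Young's inequality for B^-1 * |z(k)|. *)
Lemma dual_exponent_le (z : nat -> R) k : `|z k| <= 1 ->
  `|z k| <= B * ((if q' k != +oo%E then `|z k| `^ fine (q' k) else 0)
                 + B `^ (- p k)).
Proof.
move=> z1; have BV_gt0 : 0 < B `^ (- p k) by rewrite powR_gt0.
have p0 : 0 < p k by rewrite (lt_le_trans ltr01).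
have [pk1|pk1] := eqVneq (p k) 1.
  rewrite (le_trans z1)// mulrDr -[leLHS]add0r lerD//.
    by rewrite mulr_ge0 ?(ltW B_gt0)//; case: ifP => // _; rewrite powR_ge0.
  by rewrite pk1 powR_inv1 ?(ltW B_gt0)// divff ?gt_eqF.
have := dual_exponentP q k; rewrite /= => pq.
have q'k : q' k != +oo%E.
  by apply/eqP => /hoelder_conjugate_eqy [] /eqP; rewrite (negbTE pk1).
rewrite q'k; have q'1 := fine_exponent_ge1 q'k.
set r := fine (q' k) in q'1 *.
have q'E : q' k = r%:E.
  by rewrite /r; have := exponent_ge1 q' k; move: q'k; case: (q' k).
have r0 : 0 < r by rewrite (lt_le_trans ltr01).
move: pq; rewrite [hoelder_conjugate _]q'E !inver !gt_eqF// -EFinD => -[pr].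
have := conjugate_powR (normr_ge0 (z k)) (_ : 0 <= B^-1) r0 p0.
rewrite addrC => /(_ (ltW _) pr); rewrite invr_gt0 => /(_ B_gt0) h.
rewrite -ler_pdivrMl// mulrC (le_trans h)// lerD//.
  by rewrite ler_piMr ?powR_ge0// invf_le1.
rewrite -[B^-1]powR_inv1 ?(ltW B_gt0)// -powRrM mulN1r.
by rewrite ler_piMr ?(ltW BV_gt0)// invf_le1.
Qed.

(** For [l] admissible in the Luxemburg infimum, the preceding inequality is summed over the entries
    of [y / l]. The powers add up to at most the modular, hence to at most 1, and the remaining
    terms to at most [S]. *)
Lemma dual_lspace_sum_le (y : lspace q') n : \sum_(k < n) `|y k| <= C * `|y|.
Proof.
rewrite mulrC -ler_pdivrMr// lspace_normE.
apply: le_luxemburg => [|l l0 yl]; first exact: lspaceP.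
have z1 := le_modular1 yl.
rewrite ler_pdivrMr// mulrC -ler_pdivrMr// mulr_suml.
apply: (@le_trans _ _ (\sum_(k < n) B * ((if q' k != +oo%E
    then `|y k / l| `^ fine (q' k) else 0) + B `^ (- p k)))).
  apply: ler_sum => k _.
  have := @dual_exponent_le (fun k => y k / l) k (z1 k).
  by rewrite normrM normfV (gtr0_norm l0).
rewrite -mulr_sumr ler_wpM2l ?(ltW B_gt0)// big_split/= lerD ?sum_pB_le//.
rewrite -lee_fin; apply: le_trans yl; rewrite /modular.
apply: le_trans (leeDl _ _); last by apply: ereal_sup_ubound; left.
rewrite -sumEFin -(big_mkord xpredT (fun k => (if q' k != +oo%E
    then `|y k / l| `^ fine (q' k) else 0)%:E)).
apply: le_trans (nneseries_lim_ge n _); last first.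
  by move=> k _ _; rewrite lee_fin powR_ge0.
rewrite [leRHS]big_mkcond/=; apply: lee_sum => k _.
by case: ifP.
Qed.

(** * Functionals as finitely additive set functions *)

Lemma dual_sum_variation_le (psi : dual (lspace q)) n (F : 'I_n -> set nat) :
  trivIset setT F -> \sum_(i < n) `|psi (indic_lspace (F i))| <= C * `|psi|.
Proof.
(* Signs turn the sum of absolute values into the value of [psi] at one sequence [v]. As the sets
   are disjoint, the entries of [v] are at most 1 in absolute value. *)
move=> tF; pose s i := Num.sg (psi (indic_lspace (F i))).
set v := \sum_(i < n) s i *: indic_lspace (F i).
have -> : \sum_(i < n) `|psi (indic_lspace (F i))| = psi v.
  rewrite /v linear_sum; apply: eq_bigr => i _.
  by rewrite linearZ/= normrEsg.
rewrite (le_trans (ler_norm _))// (le_trans (dual_norm_le _ _))//.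
rewrite mulrC ler_wpM2r ?dual_norm_ge0// -[leRHS]mulr1.
apply: lspace_norm_bounded => k; rewrite /v lspace_sumE.
rewrite (le_trans (ler_norm_sum _ _ _))//.
apply: (@le_trans _ _ (\sum_(i < n) \1_(F i) k)).
  apply: ler_sum => i _; have i0 : 0 <= \1_(F i) k :> R by rewrite indicE.
  by rewrite normrM (ger0_norm i0) ler_piMl// normr_sg; case: (_ != _).
have [[i Fik]|nF] := pselect (exists i, F i k).
  rewrite (bigD1 i)//= big1 ?addr0 ?indicE ?mem_set// => j ji.
  rewrite indicE memNset// => Fjk.
  by move/trivIsetP: tF => /(_ j i I I ji)/seteqP[/(_ k (conj Fjk Fik))].
by rewrite big1// => i _; rewrite indicE memNset// => Fik; apply: nF; exists i.
Qed.

Lemma dual_indic_eq0 (psi : dual (lspace q)) :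
  (forall A, psi (indic_lspace A) = 0) -> psi = 0.
Proof.
move=> psi0; apply/val_inj/funext => v; change (psi v = 0).
apply/eqP; rewrite -normr_le0.
apply/ler_addgt0Pr => e' e'0; rewrite add0r.
have psi1 : 0 < `|psi| + 1 by rewrite ltr_wpDl.
(* With this [e], an error of norm [C * e] in the argument changes [psi] by at most [e']. The added
   1 keeps the divisor positive. *)
pose e := e' / ((`|psi| + 1) * C).
have e0 : 0 < e by rewrite divr_gt0// mulr_gt0.
have v0 k : 0 <= (v k + `|v|) / e.
  rewrite divr_ge0 ?(ltW e0)//.
  by have := lspace_norm_ge v k; rewrite ler_norml => /andP[]; lra.
(* The entries of [v] lie between minus and plus its norm. This interval is cut into steps of length
   [e], numbered from 0, and [s] rounds each entry down to the lower end of its step. *)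
pose j k := Num.truncn ((v k + `|v|) / e).
pose n := (Num.truncn ((`|v| + `|v|) / e)).+1.
have jn k : (j k < n)%N.
  rewrite ltnS le_truncn// ler_pM2r ?invr_gt0// lerD2r.
  by rewrite (le_trans (ler_norm _))// lspace_norm_ge.
set s := \sum_(i < n) (i%:R * e - `|v|) *: indic_lspace (j @^-1` [set (i : nat)]).
have psis : psi s = 0.
  by rewrite /s linear_sum big1// => i _; rewrite linearZ/= psi0 scaler0.
have sE k : s k = (j k)%:R * e - `|v|.
  rewrite /s lspace_sumE (bigD1 (Ordinal (jn k)))//= big1.
    by rewrite indicE mem_set// mulr1 addr0.
  move=> i ik; rewrite indicE memNset ?mulr0// => /= jki.
  by move: ik; rewrite -val_eqE/= jki eqxx.
have vs : `|v - s| <= C * e.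
  apply: lspace_norm_bounded => k.
  have -> : (v - s) k = v k - s k by [].
  have /andP[] := truncn_itv (v0 k); rewrite -/(j k).
  rewrite ler_pdivlMr// ltr_pdivrMr// sE -natr1 mulrDl mul1r => h1 h2.
  by rewrite ger0_norm; lra.
rewrite (_ : psi v = psi (v - s)); last by rewrite linearB/= psis subr0.
rewrite (le_trans (dual_norm_le _ _))//.
apply: (@le_trans _ _ ((`|psi| + 1) * (C * e))).
  by apply: ler_pM => //; [exact: dual_norm_ge0|rewrite lerDl].
by rewrite /e mulrA mulrC divfK// gt_eqF// mulr_gt0.
Qed.

Lemma indic_lspaceU A A' : A `&` A' = set0 ->
  indic_lspace (A `|` A') = indic_lspace A + indic_lspace A'.
Proof.
move=> AA'; apply/val_inj/funext => k.
rewrite -[RHS]/(\1_A k + \1_A' k : R) /= !indicE in_setU.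
have [kA|kA] := boolP (k \in A); have [kA'|kA'] := boolP (k \in A');
  rewrite /= ?addr0 ?add0r//.
have : (A `&` A') k by split; exact: set_mem.
by rewrite AA'.
Qed.

Lemma lspace_finite_support (v : lspace q) n :
  (forall k, (n <= k)%N -> v k = 0) ->
  v = \sum_(i < n) v i *: indic_lspace [set (i : nat)].
Proof.
move=> vn; apply/val_inj/funext => k.
change (v k = (\sum_(i < n) v i *: indic_lspace [set (i : nat)]) k).
rewrite lspace_sumE; have [nk|kn] := leqP n k.
  rewrite vn// big1// => i _; rewrite indicE memNset ?mulr0// => /= ki.
  by move: (ltn_ord i); rewrite -ki ltnNge nk.
rewrite (bigD1 (Ordinal kn))//= big1.
  by rewrite indicE mem_set// mulr1 addr0.
move=> i ik; rewrite indicE memNset ?mulr0// => /= ki.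
by move: ik; rewrite -val_eqE/= ki eqxx.
Qed.

Lemma dual_finite_support (psi : dual (lspace q)) (v : lspace q) n :
  (forall k, psi (indic_lspace [set k]) = 0) ->
  (forall k, (n <= k)%N -> v k = 0) -> psi v = 0.
Proof.
move=> psi0 /lspace_finite_support ->.
by rewrite linear_sum big1// => i _; rewrite linearZ/= psi0 scaler0.
Qed.

Lemma dual_indic_pba (psi : dual (lspace q)) :
  (forall k, psi (indic_lspace [set k]) = 0) ->
  ((fun A => psi (indic_lspace A)) : set nat -> R^o) \in pba_pred.
Proof.
move=> psi0; apply/asboolP; split.
- by move=> A A' AA'; rewrite indic_lspaceU// linearD.
- apply: (@le_lt_trans _ _ (C * `|psi|)%:E); last exact: ltry.
  apply: ge_ereal_sup => _ [n [F [tF _ ->]]].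
  by rewrite lee_fin dual_sum_variation_le.
- move=> E fE.
  have [m Em] : exists m, forall k, E k -> (k < m)%N.
    have /finite_fsetP[X EX] := fE.
    exists (\max_(k <- finmap.enum_fset X) k).+1 => k.
    by rewrite EX ltnS => kX; exact: leq_bigmax_seq.
  apply: (@dual_finite_support _ _ m) => // k mk.
  rewrite /= indicE memNset// => /Em/=.
  by rewrite ltnNge mk.
Qed.

Definition pba_of_dual (psi : dual (lspace q))
    (psi0 : forall k, psi (indic_lspace [set k]) = 0) : pba R :=
  Pba (dual_indic_pba psi0).

Lemma pba_of_dual_norm_le psi psi0 :
  `|@pba_of_dual psi psi0| <= C * `|psi|.
Proof.
rewrite -lee_fin pba_norm_variation.
apply: ge_ereal_sup => _ [n [F [tF _ ->]]].
by rewrite lee_fin dual_sum_variation_le.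
Qed.

(** Entries are bounded by the Luxemburg norm, so integration of bounded sequences restricts to a
    functional. It supplies the preimages in both isomorphisms. *)
Lemma pba_integral (mu : pba R) : exists psi : dual (lspace q),
  (forall A, psi (indic_lspace A) = mu A) /\
  forall v, `|psi v| <= `|mu| * `|v|.
Proof.
have /asboolP[addmu fmu _] := pba_funP mu.
have [I [Ilin Ile I1]] := finitely_additive_integral addmu fmu.
have bv (v : lspace q) : exists M : R, forall k, `|v k| <= M.
  by exists `|v| => k; exact: lspace_norm_ge.
have lI : linear ((fun v => I v) : lspace q -> R^o).
  by move=> c u v; exact: (Ilin c u v (bv u) (bv v)).
have bI (v : lspace q) : `|I v : R^o| <= `|mu| * `|v|.
  rewrite mulrC; apply: Ile => k; exact: lspace_norm_ge.
by exists (Dual (mem_dual lI bI)); split => // A; exact: I1.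
Qed.

(** * Coefficients and singular part of a functional *)

Definition lspace_pairing (y : lspace q') (v : lspace q) : R^o := pairing y v.

Lemma lspace_pairing_linear y : linear (lspace_pairing y).
Proof.
move=> c u v; apply: pairing_linearr (lspace_norm_ge _) (lspace_norm_ge _).
exact: dual_lspace_sum_le.
Qed.

Lemma lspace_pairing_le y v : `|lspace_pairing y v| <= C * `|y| * `|v|.
Proof.
apply: pairing_le; first exact: dual_lspace_sum_le.
exact: lspace_norm_ge.
Qed.

Definition pairing_dual y : dual (lspace q) :=
  Dual (mem_dual (@lspace_pairing_linear y) (@lspace_pairing_le y)).

Lemma pairing_dual_linear : linear pairing_dual.
Proof.
move=> c y y'; apply/val_inj/funext => v.
apply: pairing_linearl; [exact: dual_lspace_sum_le|
  exact: dual_lspace_sum_le|exact: lspace_norm_ge].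
Qed.

HB.instance Definition _ := GRing.isLinear.Build R (lspace q')
  (dual (lspace q)) *:%R pairing_dual pairing_dual_linear.

Lemma coefficients_sum_le (phi : dual (lspace q)) n :
  \sum_(k < n) `|phi (indic_lspace [set (k : nat)])| <= C * `|phi|.
Proof.
apply: dual_sum_variation_le; apply/trivIsetP => i j _ _ ij.
apply/seteqP; split => // k [/= -> /val_inj ijE].
by rewrite ijE eqxx in ij.
Qed.

(** The singletons are disjoint, so the values on them are absolutely summable and form an element
    of the dual-exponent space. *)
Definition coefficients (phi : dual (lspace q)) : lspace q' :=
  Defs.Lspace (asboolT (@luxemburg_summable _ q'
    (fun k => phi (indic_lspace [set k])) _ (coefficients_sum_le phi)).1).

Lemma coefficients_linear : linear coefficients.
Proof. by move=> c phi psi; apply/val_inj/funext. Qed.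

Lemma coefficients_norm_le phi : `|coefficients phi| <= 2 * C * `|phi|.
Proof.
rewrite lspace_normE -mulrA.
exact: (@luxemburg_summable _ q'
  (fun k => phi (indic_lspace [set k])) _ (coefficients_sum_le phi)).2.
Qed.

Lemma pairing_dual_indic1 y k : pairing_dual y (indic_lspace [set k]) = y k.
Proof. exact: pairing_indic1. Qed.

(** Since [coefficients] is a left inverse of [pairing_dual], this is the projection onto the
    functionals that vanish on every unit sequence. *)
Definition singular_part (phi : dual (lspace q)) : dual (lspace q) :=
  phi - pairing_dual (coefficients phi).

Lemma singular_part_indic1 phi k :
  singular_part phi (indic_lspace [set k]) = 0.
Proof.
rewrite -[LHS]/(phi (indic_lspace [set k]) -
  pairing_dual (coefficients phi) (indic_lspace [set k])).
by rewrite pairing_dual_indic1 subrr.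
Qed.

Lemma singular_part_linear : linear singular_part.
Proof.
move=> c phi psi; rewrite /singular_part coefficients_linear.
by rewrite pairing_dual_linear scalerBr opprD addrACA.
Qed.

Lemma pairing_dual_norm_le y : `|pairing_dual y| <= C * `|y|.
Proof.
by apply: dual_norm_le_bound; [rewrite mulr_ge0|exact: lspace_pairing_le].
Qed.

Lemma singular_part_norm_le phi :
  `|singular_part phi| <= (1 + C * (2 * C)) * `|phi|.
Proof.
rewrite (le_trans (ler_normB _ _))// mulrDl mul1r lerD2l.
rewrite (le_trans (pairing_dual_norm_le _))// -[leRHS]mulrA ler_wpM2l//.
exact: coefficients_norm_le.
Qed.

Definition dual_decomposition (phi : dual (lspace q)) :
    (lspace q' * pba R)%type :=
  (coefficients phi, pba_of_dual (singular_part_indic1 phi)).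

Lemma dual_decomposition_linear : linear dual_decomposition.
Proof.
move=> c phi psi; congr pair; first exact: coefficients_linear.
apply/val_inj/funext => A; exact: (congr1
  (fun nu : dual _ => nu (indic_lspace A)) (singular_part_linear c phi psi)).
Qed.

HB.instance Definition _ := GRing.isLinear.Build R (dual (lspace q))
  (lspace q' * pba R)%type *:%R dual_decomposition dual_decomposition_linear.

Lemma dual_lspace_isomorphic :
  isomorphic (dual (lspace q)) (lspace q' * pba R)%type.
Proof.
(* The product carries the maximum norm. The second constant adds the bounds of the two components,
   and [C + 1] adds those of the pairing and of the integral. *)
apply: (@isomorphic_of _ _ _ dual_decomposition (C + 1)
  (2 * C + C * (1 + C * (2 * C)))).
- move=> phi; rewrite prod_normE ge_max; apply/andP; split.
    rewrite (le_trans (coefficients_norm_le _))// ler_wpM2r//.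
    by rewrite lerDl mulr_ge0// addr_ge0// mulr_ge0// mulr_ge0.
  rewrite (le_trans (pba_of_dual_norm_le _))//.
  rewrite (le_trans (ler_wpM2l _ (singular_part_norm_le _)))//.
  by rewrite [leLHS]mulrA ler_wpM2r// lerDr mulr_ge0.
- move=> phi phi_mu0.
  have phi0 : coefficients phi = 0 := congr1 fst phi_mu0.
  have mu0 : (dual_decomposition phi).2 = 0 := congr1 snd phi_mu0.
  have sE : singular_part phi = phi.
    by rewrite /singular_part phi0 linear0 subr0.
  apply: dual_indic_eq0 => A; rewrite -sE.
  by have := congr1 (fun mu : pba R => mu A) mu0.
- move=> [y mu]; have [psi [psi1 psile]] := pba_integral mu.
  have mu1 k : mu [set k] = 0.
    by have /asboolP[_ _ ->] := pba_funP mu; last exact: finite_set1.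
  (* As [mu] vanishes on singletons, [psi] does not change the coefficients, and it is the singular
     part of the sum. *)
  exists (pairing_dual y + psi).
  have cE : coefficients (pairing_dual y + psi) = y.
    apply/val_inj/funext => k; rewrite -[LHS]/(
      pairing_dual y (indic_lspace [set k]) + psi (indic_lspace [set k])).
    by rewrite pairing_dual_indic1 psi1 mu1 addr0.
  split.
    congr pair; first exact: cE.
    apply/val_inj/funext => A /=.
    by rewrite /singular_part cE addrC addKr psi1.
  rewrite (le_trans (ler_normD _ _))// mulrDl mul1r lerD//.
    rewrite (le_trans (pairing_dual_norm_le _))// ler_wpM2l//.
    by rewrite prod_normE le_max lexx.
  rewrite (le_trans (dual_norm_le_bound _ psile))//.
  by rewrite prod_normE le_max lexx orbT.
Qed.

(** * The dual of the germ space *)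

Lemma bounded_support_finite (v : lspace q) :
  v \in @bounded_support_pred R q -> exists n, forall k, (n <= k)%N -> v k = 0.
Proof.
move=> /asboolP[M vM].
(* The terms of a convergent series tend to 0, while each index in the support contributes at least
   [B] to the power [- M]. *)
have cpB : cvgn (series (fun k => B `^ (- p k))).
  apply: nondecreasing_is_cvgn.
    by apply: nondecreasing_series => k _ _; exact: powR_ge0.
  by exists S => _ [n _ <-]; rewrite seriesEord sum_pB_le.
have BM0 : 0 < B `^ (- M) by rewrite powR_gt0.
have /cvgrPdist_lt/(_ _ BM0)[n _ nB] := cvg_series_cvg_0 cpB.
exists n => k nk; apply/eqP/negPn/negP => /vM; rewrite lee_fin => pkM.
have := nB k nk; rewrite /= sub0r normrN ger0_norm ?powR_ge0//.
by rewrite ltNge ler_powR ?lerN2// ltW.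
Qed.

Lemma indic1_bounded_support k :
  indic_lspace [set k] \in @bounded_support_pred R q.
Proof.
apply/asboolP; exists (p k) => j; have [->|jk] := eqVneq j k; first by rewrite lexx.
rewrite /= indicE memNset ?eqxx// => /= jkE.
by rewrite jkE eqxx in jk.
Qed.

Local Notation pi := (closure_pi (@bounded_support_pred R q)).

Lemma germ_pi_linear : linear (pi : lspace q -> germ q).
Proof. by move=> c u v; rewrite closure_piD -closure_piZ. Qed.

Lemma dual_germ_pi_linear (psi : dual (germ q)) :
  linear ((fun v => psi (pi v)) : lspace q -> R^o).
Proof. by move=> c u v; rewrite germ_pi_linear linearP. Qed.

Lemma dual_germ_pi_le (psi : dual (germ q)) v : `|psi (pi v)| <= `|psi| * `|v|.
Proof.
apply: le_trans (dual_norm_le _ _) _; rewrite ler_wpM2l ?dual_norm_ge0//.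
exact: quot_norm_le.
Qed.

Definition germ_dual_pullback (psi : dual (germ q)) : dual (lspace q) :=
  Dual (mem_dual (dual_germ_pi_linear psi) (dual_germ_pi_le psi)).

Lemma germ_dual_pullback_indic1 psi k :
  germ_dual_pullback psi (indic_lspace [set k]) = 0.
Proof.
have piE : pi (indic_lspace [set k]) = 0.
  apply/closure_pi_eq0/closure_predP => e e0.
  exists (indic_lspace [set k]); first exact: indic1_bounded_support.
  by rewrite subrr normr0.
rewrite -[LHS]/(psi (pi (indic_lspace [set k]))) piE.
exact: (linear0 psi).
Qed.

Definition germ_dual_measure (psi : dual (germ q)) : pba R :=
  pba_of_dual (germ_dual_pullback_indic1 psi).

Lemma germ_dual_measure_linear : linear germ_dual_measure.
Proof. by move=> c phi psi; apply/val_inj/funext. Qed.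

HB.instance Definition _ := GRing.isLinear.Build R (dual (germ q))
  (pba R) *:%R germ_dual_measure germ_dual_measure_linear.

Lemma dual_closure_eq0 (phi : dual (lspace q)) v :
  (forall k, phi (indic_lspace [set k]) = 0) ->
  v \in closure_pred (@bounded_support_pred R q) -> phi v = 0.
Proof.
move=> phi0 /closure_predP cv; apply/eqP; rewrite -normr_le0.
apply/ler_addgt0Pr => e e0; rewrite add0r.
have phi1 : 0 < `|phi| + 1 by rewrite ltr_wpDl.
have [w /bounded_support_finite[n wn] vw] := cv _ (divr_gt0 e0 phi1).
rewrite (_ : phi v = phi (v - w)); last first.
  by rewrite linearB/= (dual_finite_support phi0 wn) subr0.
rewrite (le_trans (dual_norm_le _ _))//.
apply: (@le_trans _ _ ((`|phi| + 1) * (e / (`|phi| + 1)))).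
  by apply: ler_pM => //; [exact: dual_norm_ge0|rewrite lerDl|exact: ltW].
by rewrite mulrC divfK// gt_eqF.
Qed.

(** Two representatives differ by an element of the closure, where [phi] vanishes, so any choice [r]
    of representatives defines [psi]. Its bound comes from the infimum over all representatives. *)
Lemma dual_germ_factor (phi : dual (lspace q)) (N : R) : 0 <= N ->
  (forall k, phi (indic_lspace [set k]) = 0) ->
  (forall v, `|phi v| <= N * `|v|) ->
  exists psi : dual (germ q),
    (forall v, psi (pi v) = phi v) /\ `|psi| <= N.
Proof.
move=> N0 phi0 phiN.
have /choice[r rK] := @closure_pi_surj _ _ (@bounded_support_pred R q).
have phir v : phi (r (pi v)) = phi v.
  apply/eqP; rewrite -subr_eq0 -linearB; apply/eqP/dual_closure_eq0 => //.
  by apply/closure_piP; rewrite rK.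
have lpsi : linear ((fun u => phi (r u)) : germ q -> R^o).
  move=> c u u'; rewrite -{1}(rK u) -{1}(rK u').
  by rewrite -germ_pi_linear phir linearP.
have psiN (u : germ q) : `|phi (r u)| <= N * `|u|.
  (* The comparison with the infimum divides by [N], so [N = 0] is treated apart. *)
  move: N0; rewrite le_eqVlt => /predU1P[N0|N0].
    by rewrite -N0 mul0r (le_trans (phiN _))// -N0 mul0r.
  rewrite -ler_pdivrMl//; apply: le_quot_norm => v <-.
  by rewrite ler_pdivrMl// phir.
exists (Dual (mem_dual lpsi psiN)); split; first exact: phir.
exact: dual_norm_le_bound.
Qed.

Lemma dual_germ_isomorphic : isomorphic (dual (germ q)) (pba R).
Proof.
apply: (@isomorphic_of _ _ _ germ_dual_measure 1 C).
- move=> psi; rewrite (le_trans (pba_of_dual_norm_le _))// ler_wpM2l//.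
  apply: dual_norm_le_bound; last exact: (dual_germ_pi_le psi).
  exact: normr_ge0.
(* The measure consists of the values of the pullback on indicators, which determine it.
   Surjectivity of the quotient map then gives [psi = 0]. *)
- move=> psi psi0; have pull0 : germ_dual_pullback psi = 0.
    apply: dual_indic_eq0 => A.
    exact: (congr1 (fun mu : pba R => mu A) psi0).
  apply/val_inj/funext => u; have [v <-] := closure_pi_surj u.
  exact: (congr1 (fun phi : dual (lspace q) => phi v) pull0).
- move=> mu; have [phi [phi1 phile]] := pba_integral mu.
  have phi0 k : phi (indic_lspace [set k]) = 0.
    rewrite phi1; have /asboolP[_ _ mu0] := pba_funP mu.
    by apply: mu0; exact: finite_set1.
  have [psi [psiE psile]] := dual_germ_factor (normr_ge0 mu) phi0 phile.
  exists psi; split; last by rewrite mul1r.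
  apply/val_inj/funext => A; rewrite -[RHS]phi1.
  exact: (psiE (indic_lspace A)).
Qed.

End spaces.

Theorem theorem3p5 (R : realType) (p : nat -> R)
    (p_ge1 : forall k, 1 <= p k)
    (p_sum : exists B : R,
       1 < B /\ (\sum_(0 <= k <oo) (B `^ (- p k))%:E < +oo)%E) :
  isomorphic (dual (lspace (real_exponent p_ge1)))
    (lspace (dual_exponent (real_exponent p_ge1)) * pba R)%type
  /\ isomorphic (dual (germ (real_exponent p_ge1))) (pba R).
Proof.
have [B [B_gt1 pB]] := p_sum; split.
  exact: dual_lspace_isomorphic B_gt1 pB.
exact: dual_germ_isomorphic B_gt1 pB.
Qed.
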